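(* Let $C_C=V(p^3-q^2)\subset\mathbb{C}^2$ and $C_D=V(p^2+18p-8q-27)\subset\mathbb{C}^2$. (1) For $d=2$ and $d=3$, the branch locus of $g_d:\mathbb{C}^2\to\mathbb{C}^2$ consists of $C_C$ and $C_D$, i.e. equals $C_C\cup C_D$. (2) The branch locus of $\tilde F:\mathbb{C}^2\to\mathbb{C}^2$, $\tilde F(x,y)=(x^2+y^2,\,x^3-3xy^2)$, is $C_C$.
   Context: For a finite dominant morphism $f:X\to Y$ of irreducible complex affine varieties of equal dimension with $Y$ normal, a point $y\in Y$ is a branch point of $f$ if the number of points of $f^{-1}(y)$ is less than $\deg f$; the branch locus is the set of branch points. The maps $g_2$ and $g_3$ (which are finite, of degrees $4$ and $9$) are $g_2(p,q)=(4p+p^2-4q,\ 12p^2-8q-6pq+2q^2-p^3)$ and $g_3(p,q)=(9-18p+9p^2+p^3+6q-6pq,\ 9p^4-3p^3q-36p^3+27p^2q+81p^2-18pq^2-54pq-81p+4q^3+18q^2+27q+27)$. They are the maps induced on $\mathbb{C}^2/D_3\simeq\mathbb{C}^2$ by the Chebyshev endomorphisms, i.e. $g_d\circ\tilde F=\tilde F\circ f_d$, with $f_2(x,y)=(x^2-y^2-2x,\,2xy+2y)$ and $f_3(x,y)=(x^3-3xy^2-3x^2-3y^2+3,\,3x^2y-y^3)$. $\tilde F$ is the quotient map by the dihedral group of order 6. *)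

(* Defs.v *)
From mathcomp Require Import all_boot all_order all_algebra.
From mathcomp Require Import mpoly complex.
From mathcomp Require Import boolp classical_sets cardinality reals.

Set Implicit Arguments.
Unset Strict Implicit.
Unset Printing Implicit Defensive.

Import GRing.Theory.

Local Open Scope classical_set_scope.
Local Open Scope ring_scope.

Section PolynomialMaps.
Variable K : fieldType.

(* Closed points of affine n-space are row vectors.  A morphism A^n -> A^m is
   the m-tuple of its component polynomials, so that [f^* a] is [a \mPo f]. *)
Definition point n (v : 'rV[K]_n) : 'I_n -> K := v ord0.

Definition polymap n m (f : m.-tuple {mpoly K[n]}) (v : 'rV[K]_n) : 'rV[K]_m :=
  \row_j (tnth f j).@[point v].

Definition zero_locus n (P : {mpoly K[n]}) : set 'rV[K]_n :=
  [set v | P.@[point v] = 0].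

(* The image f^* K(A^m) of the function field of the target inside the function
   field K(A^n) of the source; it is a copy of K(A^m) as soon as f is
   dominant, i.e. f^* is injective. *)
Definition pullback_field n m (f : m.-tuple {mpoly K[n]}) :
    set {fraction {mpoly K[n]}} :=
  [set h | exists a b : {mpoly K[m]}, b \mPo f != 0 /\
     h = FracField.tofrac (a \mPo f) / FracField.tofrac (b \mPo f)].

(* deg f = [K(A^n) : f^* K(A^m)] = d, i.e. K(A^n) has a basis with d elements
   over the subfield f^* K(A^m).  No d qualifies when this extension is
   infinite. *)
Definition has_degree n m (f : m.-tuple {mpoly K[n]}) (d : nat) : Prop :=
  exists e : 'I_d -> {fraction {mpoly K[n]}},
    forall h : {fraction {mpoly K[n]}},
      exists! c : {ffun 'I_d -> {fraction {mpoly K[n]}}},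
        (forall i, pullback_field f (c i)) /\ h = \sum_i c i * e i.

Section DegreeUniqueness.
Variables (n m : nat) (f : m.-tuple {mpoly K[n]}).

Lemma pullback_field0 : pullback_field f 0.
Proof. by exists 0, 1; rewrite rmorph1 oner_eq0 !rmorph0 mul0r. Qed.

Lemma pullback_field1 : pullback_field f 1.
Proof. by exists 1, 1; rewrite rmorph1 oner_eq0 rmorph1 divr1. Qed.

Lemma pullback_fieldD g h :
  pullback_field f g -> pullback_field f h -> pullback_field f (g + h).
Proof.
move=> [a [b [b0 ->]]] [c [d [d0 ->]]].
exists (a * d + c * b), (b * d); split; first by rewrite rmorphM mulf_neq0.
by rewrite addf_div ?tofrac_eq0 // !rmorphD /= !rmorphM.
Qed.

Lemma pullback_fieldM g h :
  pullback_field f g -> pullback_field f h -> pullback_field f (g * h).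
Proof.
move=> [a [b [b0 ->]]] [c [d [d0 ->]]].
exists (a * c), (b * d); split; first by rewrite rmorphM mulf_neq0.
by rewrite mulf_div !rmorphM.
Qed.

Lemma has_degree_le d1 d2 : has_degree f d1 -> has_degree f d2 -> (d1 <= d2)%N.
Proof.
move=> [e1 B1] [e2 B2].
have /choice[M MP] i : exists c : {ffun 'I_d2 -> {fraction {mpoly K[n]}}},
    (forall j, pullback_field f (c j)) /\ e1 i = \sum_j c j * e2 j.
  by have [c [cP _]] := B2 (e1 i); exists c.
have /choice[N NP] j : exists c : {ffun 'I_d1 -> {fraction {mpoly K[n]}}},
    (forall i, pullback_field f (c i)) /\ e2 j = \sum_i c i * e1 i.
  by have [c [cP _]] := B1 (e2 j); exists c.
pose A := \matrix_(i, j) M i j; pose B := \matrix_(j, i) N j i.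
suff AB1 : A *m B = 1%:M by rewrite -(mxrank1 {fraction {mpoly K[n]}} d1) -AB1 mulmx_max_rank.
apply/matrixP => i k; have [c [_ cU]] := B1 (e1 i).
have c1 : c = [ffun l => (A *m B) i l].
  apply: cU; split=> [l|].
    rewrite ffunE mxE.
    apply: (big_ind (pullback_field f)); first exact: pullback_field0.
      exact: pullback_fieldD.
    move=> j _; rewrite !mxE; apply: pullback_fieldM.
      by have [] := MP i.
    by have [] := NP j.
  have [_ {1}->] := MP i.
  under eq_bigr => j _.
    have [_ ->] := NP j; rewrite mulr_sumr; over.
  rewrite exchange_big; apply: eq_bigr => l _; rewrite ffunE mxE mulr_suml.
  by apply: eq_bigr => j _; rewrite !mxE mulrA.
have c2 : c = [ffun l => (i == l)%:R].
  apply: cU; split=> [l|].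
    rewrite ffunE; case: (i == l); first exact: pullback_field1.
    exact: pullback_field0.
  rewrite (bigD1 i) //= ffunE eqxx mul1r big1 ?addr0 // => l li.
  by rewrite ffunE eq_sym (negPf li) mul0r.
by move: c1; rewrite c2 => /ffunP/(_ k); rewrite !ffunE => <-; rewrite mxE.
Qed.

Lemma has_degree_uniq d1 d2 : has_degree f d1 -> has_degree f d2 -> d1 = d2.
Proof. by move=> h1 h2; apply/eqP; rewrite eqn_leq !has_degree_le. Qed.

End DegreeUniqueness.

(* The value is 0 when the extension of function fields is infinite. *)
Definition degree n m (f : m.-tuple {mpoly K[n]}) : nat :=
  xget 0%N (has_degree f).

Lemma degreeE n m (f : m.-tuple {mpoly K[n]}) d : has_degree f d -> degree f = d.
Proof.
move=> fd; rewrite /degree; case: xgetP => [d' _ fd'|/(_ d) //].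
exact: has_degree_uniq fd' fd.
Qed.

(* For f finite, the fibre over y is finite; y is a branch point when its
   number k of points is less than deg f. *)
Definition branch_locus n (f : n.-tuple {mpoly K[n]}) : set 'rV[K]_n :=
  [set y | exists2 k, (k < degree f)%N &
     (polymap f @^-1` [set y] #= `I_k)%card].

End PolynomialMaps.

Section Maps.
Variable K : fieldType.

Local Notation p := ('X_0 : {mpoly K[2]}).
Local Notation q := ('X_1 : {mpoly K[2]}).
Local Notation x := ('X_0 : {mpoly K[2]}).
Local Notation y := ('X_1 : {mpoly K[2]}).

Definition g2 : 2.-tuple {mpoly K[2]} :=
  [tuple 4 * p + p ^+ 2 - 4 * q;
         12 * p ^+ 2 - 8 * q - 6 * p * q + 2 * q ^+ 2 - p ^+ 3].

Definition g3 : 2.-tuple {mpoly K[2]} :=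
  [tuple 9 - 18 * p + 9 * p ^+ 2 + p ^+ 3 + 6 * q - 6 * p * q;
         9 * p ^+ 4 - 3 * p ^+ 3 * q - 36 * p ^+ 3 + 27 * p ^+ 2 * q
         + 81 * p ^+ 2 - 18 * p * q ^+ 2 - 54 * p * q - 81 * p
         + 4 * q ^+ 3 + 18 * q ^+ 2 + 27 * q + 27].

Definition Ftilde : 2.-tuple {mpoly K[2]} :=
  [tuple x ^+ 2 + y ^+ 2; x ^+ 3 - 3 * x * y ^+ 2].

Definition C_C : set 'rV[K]_2 := zero_locus (p ^+ 3 - q ^+ 2).

Definition C_D : set 'rV[K]_2 := zero_locus (p ^+ 2 + 18 * p - 8 * q - 27).

End Maps.

Arguments C_C : clear implicits.
Arguments C_D : clear implicits.

(* Main.v *)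
From Pilot Require Import Defs.
From mathcomp Require Import all_boot all_order all_algebra.
From mathcomp Require Import mpoly complex cyclic separable cyclotomic.
From mathcomp Require Import fraction.
From mathcomp Require Import boolp classical_sets cardinality reals.
From mathcomp Require Import ring.

(** With U = a + b + c and V = 1/a + 1/b + 1/c on the torus abc = 1, the map
    (a, b) |-> (p, q) = (3 + (U + V), 9/2 + 3 (U + V) + UV/2) is the quotient by
    the Weyl group W of type G2, generated by the permutations of (a, b, c) and
    the simultaneous inversion, and it intertwines g_d with (a, b) |-> (a^d, b^d).
    The defining polynomial of C_D pulls back to (U - V)^2 and that of C_C, up
    to the factor -4, to the discriminant of (a, b, c), so C_C and C_D together
    are the image of the points with non-trivial stabiliser in W.  The fibre of
    g_d over the image of (a^d, b^d) is the image of the d^2 points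
    (z^i a, z^j b), z a primitive d-th root of unity: two of them with the same
    image differ by an element of W fixing (a^d, b^d), and conversely a
    reflection fixing (a^d, b^d) identifies two of them.

    The degree is computed from the fibres: monomials x^i y^j, i < r, j < s,
    generate K[x, y] over f^* K[x, y], and as soon as the fibre over a general
    point has r s elements, evaluation on the fibre shows that they are free.  *)

Set Implicit Arguments.
Unset Strict Implicit.
Unset Printing Implicit Defensive.

Import GRing.Theory Num.Theory.

Local Open Scope classical_set_scope.
Local Open Scope ring_scope.

(* [point] also names the canonical element of a pointed type. *)
Local Notation coords := Pilot.Defs.point.

(** * Polynomials vanishing at every point *)

Section VanishingPolynomials.
Variable K : closedFieldType.

(** If [p] vanishes everywhere, [p + 1] has no root, so over a closed field it is constant. *)
Lemma horner_eq0_closed (p : {poly K}) : (forall x, p.[x] = 0) -> p = 0.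
Proof.
move=> p0; case: (closed_rootP (p + 1)) => [[x]|].
  by rewrite /root hornerD p0 add0r hornerC oner_eq0.
move=> nroot; have sz : size (p + 1) == 1%N.
  by apply/negPn/negP => /closed_rootP; exact: nroot.
have /size_poly1P[c _ pE] := sz.
have := p0 0; rewrite -[p](addrK 1) pE hornerD hornerN !hornerC => /eqP.
by rewrite subr_eq0 => /eqP ->; rewrite subrr.
Qed.

(** [muni] singles out the last variable; reading the coefficients of [p] off [muni p] drives the
    induction of [meval_eq0]. *)
Lemma muni_coef n (p : {mpoly K[n.+1]}) (m : 'X_{1..n.+1}) :
  (muni p)`_(m ord_max)@_[multinom m (widen_ord (leqnSn n) i) | i < n] = p@_m.
Proof.
rewrite muniE coef_sum raddf_sum /=.
have termE (m' : 'X_{1..n.+1}) : 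
  (p@_m' *: 'X_[[multinom m' (widen_ord (leqnSn n) i) | i < n]] *: 'X^(m' ord_max))
    `_(m ord_max)@_[multinom m (widen_ord (leqnSn n) i) | i < n]
  = p@_m' * (m' == m)%:R.
  rewrite coefZ coefXn.
  have -> : (m' == m) = (m ord_max == m' ord_max) &&
      ([multinom m' (widen_ord (leqnSn n) i) | i < n] ==
       [multinom m (widen_ord (leqnSn n) i) | i < n]).
    apply/eqP/andP => [->//|[/eqP e1 /eqP/mnmP e2]].
    apply/mnmP => i; have [j ->|->] := unliftP ord_max i; last by [].
    have := e2 j; rewrite !mnmE; congr (m' _ = m _); apply/val_inj => /=;
    by rewrite /bump leqNgt ltn_ord.
  case: eqP => _ /=; last by rewrite mulr0 mcoeff0 mulr0.
  by rewrite mulr1 mcoeffZ mcoeffX.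
under eq_bigr do rewrite termE.
have [mp|mp] := boolP (m \in msupp p).
  rewrite (bigD1_seq m) //= ?msupp_uniq // eqxx mulr1 big1 ?addr0 // => i /negPf->.
  by rewrite mulr0.
rewrite memN_msupp_eq0 // big_seq big1 // => i ip.
by case: eqP mp => [<-|]; rewrite ?ip // mulr0.
Qed.

Lemma meval_eq0 n (p : {mpoly K[n]}) : (forall v, p.@[v] = 0) -> p = 0.
Proof.
elim: n p => [|n IHn] p p0.
  apply/mpolyP => m; have := p0 (fun=> 0); rewrite mevalE mcoeff0.
  have u0 (m' : 'X_{1..0}) : m' = m by apply/mnmP; case.
  have [mp|mp] := boolP (m \in msupp p); last by rewrite memN_msupp_eq0.
  rewrite (bigD1_seq m) //= ?msupp_uniq // big_ord0 mulr1 big1 ?addr0 // => i.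
  by rewrite (u0 i) eqxx.
suff c0 k : (muni p)`_k = 0.
  by apply/mpolyP => m; rewrite -muni_coef c0 !mcoeff0.
apply: IHn => v; rewrite -[_.@[v]](coef_map (meval v)) /=.
suff -> : map_poly (meval v) (muni p) = 0 by rewrite coef0.
apply: horner_eq0_closed => x.
pose w (i : 'I_n.+1) := if unlift ord_max i is Some j then v j else x.
rewrite -[RHS](p0 w) muniE rmorph_sum horner_sum mevalE.
apply: eq_bigr => m _ /=.
rewrite map_polyZ map_polyXn hornerZ hornerXn /= mevalZ mevalX.
rewrite big_ord_recr /= -!mulrA; congr (_ * (_ * _)); last first.
  by rewrite /w unlift_none.
apply: eq_bigr => i _; rewrite mnmE /w; congr (_ ^+ _).
have -> : widen_ord (leqnSn n) i = lift ord_max i.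
  by apply/val_inj => /=; rewrite /bump leqNgt ltn_ord.
by rewrite liftK.
Qed.

End VanishingPolynomials.

(** * Fractions and multiples lying in a subring *)

Lemma fraction_quotient (R : idomainType) (x : {fraction R}) :
  exists a b : R, b != 0 /\ x = FracField.tofrac a / FracField.tofrac b.
Proof.
elim/quotW: x => r; exists (frac r).1, (frac r).2.
have r0 := denom_ratioP r; split=> //.
apply: (canRL (mulfK _)); first by rewrite tofrac_eq0.
rewrite /GRing.mul /= !piE; apply/eqmodP => /=.
by rewrite equivfE /mulf !numden_Ratio ?mulr1 ?oner_eq0 // mulrC.
Qed.

(** Since [x != 0], factors X can be stripped from [p] until its constant coefficient is non-zero;
    that coefficient is [w], and the root equation makes its image a multiple of [x]. *)
Lemma root_divides_coef (A B : idomainType) (phi : {rmorphism A -> B})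
    (p : {poly A}) x :
  injective phi -> p != 0 -> root (map_poly phi p) x -> x != 0 ->
  exists w x', w != 0 /\ phi w = x * x'.
Proof.
move=> phi_inj + + x0; elim/poly_ind: p => [|p c IHp]; first by rewrite eqxx.
rewrite rmorphD rmorphM /= map_polyX map_polyC /root hornerMXaddC => p0 /eqP rp.
have [c0|c0] := eqVneq c 0.
  apply: IHp; first by apply: contraNneq p0 => ->; rewrite c0 mul0r add0r.
  by apply/eqP/(mulIf x0); rewrite mul0r -[LHS]addr0 -[in LHS](rmorph0 phi) -c0.
exists c, (- (map_poly phi p).[x]); split=> //.
by rewrite mulrN mulrC; apply/eqP; rewrite -addr_eq0 addrC rp.
Qed.

(** * Generators over the pulled-back coordinate ring *)

Section Spanning.
Variables (K : closedFieldType) (n m : nat) (f : m.-tuple {mpoly K[n]}).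
Variables (d : nat) (e : 'I_d -> {mpoly K[n]}).

Definition pullback_span : set {mpoly K[n]} :=
  [set h | exists a : 'I_d -> {mpoly K[m]}, h = \sum_i (a i \mPo f) * e i].

Lemma pullback_spanD g h :
  pullback_span g -> pullback_span h -> pullback_span (g + h).
Proof.
move=> [a ->] [b ->]; exists (fun i => a i + b i).
by rewrite -big_split; apply: eq_bigr => i _; rewrite rmorphD mulrDl.
Qed.

Lemma pullback_spanM a h :
  pullback_span h -> pullback_span ((a \mPo f) * h).
Proof.
move=> [b ->]; exists (fun i => a * b i).
by rewrite mulr_sumr; apply: eq_bigr => i _; rewrite rmorphM mulrA.
Qed.

Lemma pullback_spanZ c h : pullback_span h -> pullback_span (c *: h).
Proof.
by move=> /(pullback_spanM c%:MP_[m]); rewrite comp_mpolyC mul_mpolyC.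
Qed.

Lemma pullback_spanB g h :
  pullback_span g -> pullback_span h -> pullback_span (g - h).
Proof.
by move=> sg sh; rewrite -scaleN1r; apply: pullback_spanD => //; apply: pullback_spanZ.
Qed.

Lemma pullback_span_tnth (i : 'I_m) h :
  pullback_span h -> pullback_span (tnth f i * h).
Proof.
by move=> /(pullback_spanM 'X_i); rewrite comp_mpolyXU (tnth_nth 0).
Qed.

Lemma pullback_span_basis i : pullback_span (e i).
Proof.
exists (fun j => (j == i)%:R); rewrite (bigD1 i) //= eqxx rmorph1 mul1r.
by rewrite big1 ?addr0 // => j /negPf ->; rewrite rmorph0 mul0r.
Qed.

Lemma pullback_span_sum I (r : seq I) F :
  (forall i, pullback_span (F i)) -> pullback_span (\sum_(i <- r) F i).
Proof.
move=> sF; apply: (big_ind pullback_span) => //; last exact: pullback_spanD.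
by exists (fun=> 0); rewrite big1 // => i _; rewrite rmorph0 mul0r.
Qed.

(** The span is stable under multiplication by every variable, so from 1 it reaches all
    monomials. *)
Lemma pullback_span_full :
  pullback_span 1 -> (forall k i, pullback_span ('X_k * e i)) ->
  forall h, pullback_span h.
Proof.
move=> s1 sX h.
have sXh k g : pullback_span g -> pullback_span ('X_k * g).
  move=> [a ->]; rewrite mulr_sumr; apply: pullback_span_sum => i.
  by rewrite mulrCA; apply: pullback_spanM.
rewrite [h]mpolyE; apply: pullback_span_sum => mm; apply: pullback_spanZ.
rewrite mpolyXE_id; elim/big_rec: _ => [//|k g _ sg].
elim: (mm k) => [|j IH]; first by rewrite mul1r.
by rewrite exprS -mulrA; apply: sXh.
Qed.

End Spanning.

(** * The degree from general fibres *)

Section DegreeFromFibre.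
Variables (K : closedFieldType) (n : nat).

(** Lagrange interpolation: a product of affine forms, each separating two points by a coordinate in
    which they differ. *)
Lemma interpolation d (P : 'I_d -> 'rV[K]_n) : injective P ->
  exists h : 'I_d -> {mpoly K[n]},
    forall k j, (h k).@[coords (P j)] = (k == j)%:R.
Proof.
move=> Pinj.
have sep j k : exists l : {mpoly K[n]},
    l.@[coords (P k)] = 1 /\ (j != k -> l.@[coords (P j)] = 0).
  have [->|jk] := eqVneq j k; first by exists 1; rewrite meval1.
  have /eqP/rowP/eqfunP := contra_neq (@Pinj j k) jk.
  rewrite negb_forall => /existsP[i Pi].
  have Pi0 : P k ord0 i - P j ord0 i != 0 by rewrite subr_eq0 eq_sym.
  exists ((P k ord0 i - P j ord0 i)^-1 *: ('X_i - (P j ord0 i)%:MP)).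
  rewrite !mevalZ !mevalB !mevalXU !mevalC /coords mulVf // subrr mulr0.
  by [].
have /choice[l lP] jk := sep jk.1 jk.2.
exists (fun k => \prod_j l (j, k)) => k j; rewrite rmorph_prod /=.
have [<-|kj] := eqVneq k j.
  by rewrite big1 // => i _; have [] := lP (i, k).
by rewrite (bigD1 j) //=; have [_ ->] := lP (j, k); rewrite ?mul0r // eq_sym.
Qed.

Variables (m : nat) (f : m.-tuple {mpoly K[n]}).

Lemma meval_comp_polymap (a : {mpoly K[m]}) v :
  (a \mPo f).@[coords v] = a.@[coords (polymap f v)].
Proof.
by rewrite comp_mpoly_meval; apply: meval_eq => i; rewrite /coords mxE.
Qed.

Variables (d : nat) (e : 'I_d -> {mpoly K[n]}).
Hypothesis e_span : forall h, pullback_span f e h.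

(** Expanding interpolation polynomials in the generators gives a left inverse of the square matrix
    of values of [e i] at [P j]. This matrix is thus invertible, and a relation evaluated on the
    fibre has zero coefficients at [y]. *)
Lemma coef_eq0_fibre (b : 'I_d -> {mpoly K[m]}) y (P : 'I_d -> 'rV[K]_n) :
  injective P -> (forall j, polymap f (P j) = y) ->
  \sum_i (b i \mPo f) * e i = 0 -> forall i, (b i).@[coords y] = 0.
Proof.
move=> /interpolation[h hP] fP b0 i.
have /choice[a aP] k := e_span (h k).
pose E := \matrix_(i, j) (e i).@[coords (P j)].
pose A := \matrix_(k, i) (a k i).@[coords y].
have AE : A *m E = 1%:M.
  apply/matrixP => k j; rewrite !mxE -hP aP rmorph_sum /=.
  by apply: eq_bigr => l _; rewrite !mxE rmorphM /= meval_comp_polymap fP.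
have bE : (\row_i (b i).@[coords y]) *m E = 0.
  apply/rowP => j; rewrite !mxE -[RHS](meval0 (coords (P j))) -b0 rmorph_sum /=.
  by apply: eq_bigr => l _; rewrite !mxE rmorphM /= meval_comp_polymap fP.
have : (\row_i (b i).@[coords y]) = 0.
  by rewrite -[LHS]mulmx1 -(mulmx1C AE) mulmxA bE mul0mx.
by move=> /rowP/(_ i); rewrite !mxE.
Qed.

Variable D : {mpoly K[m]}.
Hypothesis D_neq0 : D != 0.
Hypothesis fibre_D : forall y, D.@[coords y] != 0 ->
  exists P : 'I_d -> 'rV[K]_n, injective P /\ forall j, polymap f (P j) = y.

(** [D * b i] vanishes everywhere: where [D] is non-zero, the [d] points of the fibre force [b i] to
    vanish. *)
Lemma pullback_free (b : 'I_d -> {mpoly K[m]}) :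
  \sum_i (b i \mPo f) * e i = 0 -> forall i, b i = 0.
Proof.
move=> b0 i; suff /eqP : D * b i = 0 by rewrite mulf_eq0 (negPf D_neq0) => /eqP.
apply: meval_eq0 => v; rewrite mevalM.
have vE : v =1 coords (\row_j v j) by move=> j; rewrite /coords mxE.
rewrite !(meval_eq _ vE).
have [->|D0] := eqVneq D.@[coords (\row_j v j)] 0; first by rewrite mul0r.
have [P [Pinj fP]] := fibre_D D0.
by rewrite (coef_eq0_fibre Pinj fP b0) mulr0.
Qed.

(** If [a] pulls back to 0, multiplying an expansion of 1 by [a] gives a relation; freeness kills
    every [a * u i], hence every [u i] if [a != 0], hence 1. *)
Lemma comp_mpoly_inj : injective (comp_mpoly f).
Proof.
apply: raddf_inj => a a0; have [u uE] := e_span 1.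
have aE : \sum_i ((a * u i) \mPo f) * e i = 0.
  under eq_bigr do rewrite rmorphM /= -mulrA.
  by rewrite -mulr_sumr -uE a0 mul0r.
apply/eqP; apply: contraT => aN0.
have u0 i : u i = 0.
  by have /eqP := pullback_free aE i; rewrite mulf_eq0 (negPf aN0) => /eqP.
suff : (1 : {mpoly K[n]}) = 0 by move/eqP; rewrite oner_eq0.
by rewrite uE big1 // => i _; rewrite u0 comp_mpoly0 mul0r.
Qed.

Lemma comp_mpoly_neq0 (a : {mpoly K[m]}) : (a \mPo f != 0) = (a != 0).
Proof. by rewrite -{1}(comp_mpoly0 f) (inj_eq comp_mpoly_inj). Qed.

(* Multiplication by [h] on K[A^n], written in the generators [e], has a
   characteristic polynomial over K[A^m] which vanishes at [h]. *)
Lemma pullback_multiple (h : {mpoly K[n]}) : h != 0 ->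
  exists w h', w != 0 /\ w \mPo f = h * h'.
Proof.
move=> h0.
pose phi : {rmorphism {mpoly K[n]} -> {fraction {mpoly K[n]}}} :=
  @FracField.tofrac {mpoly K[n]}.
have /choice[M ME] i := e_span (h * e i).
(* Transposed because eigenvectors are rows: the row of the [e i] has eigenvalue [h], and is
   non-zero since the [e i] generate 1. *)
pose A := \matrix_(i, j) M j i.
apply: (root_divides_coef (p := char_poly A) comp_mpoly_inj _ _ h0).
  exact/monic_neq0/char_poly_monic.
rewrite /root -tofrac_eq0 -[FracField.tofrac _]/(phi _).
rewrite -horner_map -map_poly_comp /= -/(root _ _) map_char_poly.
rewrite -eigenvalue_root_char; apply/eigenvalueP.
exists (\row_i phi (e i)); last first.
  have [u uE] := e_span 1; apply: contraTneq (oner_neq0 {mpoly K[n]}) => /rowP e0.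
  rewrite negbK uE big1 // => i _; have := e0 i; rewrite !mxE => /eqP.
  by rewrite tofrac_eq0 => /eqP ->; rewrite mulr0.
apply/rowP => j; rewrite !mxE -rmorphM ME rmorph_sum.
by apply: eq_bigr => i _; rewrite !mxE rmorphM mulrC.
Qed.

Local Notation "x %:F" := (@FracField.tofrac {mpoly K[n]} x).

(** Multiplying by the product of all denominators gives a relation with polynomial coefficients
    [c j]. *)
Lemma pullback_field_free (g : 'I_d -> {fraction {mpoly K[n]}}) :
  (forall i, pullback_field f (g i)) -> \sum_i g i * (e i)%:F = 0 ->
  forall i, g i = 0.
Proof.
move=> /choice[a /choice[b gE]] g0 i.
have bN0 j : b j != 0 by have [] := gE j; rewrite comp_mpoly_neq0.
pose c j := a j * \prod_(k | k != j) b k.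
have cE j : (c j \mPo f)%:F = (\prod_k b k \mPo f)%:F * g j.
  have [bj ->] := gE j; rewrite (bigD1 j) //= !rmorphM /=.
  by rewrite [RHS]mulrC [RHS]mulrA divfK // tofrac_eq0.
have c0 : c i = 0.
  apply: pullback_free i; apply/eqP; rewrite -tofrac_eq0 rmorph_sum /=.
  under eq_bigr do rewrite rmorphM /= cE -mulrA.
  by rewrite -mulr_sumr g0 mulr0.
have [bi ->] := gE i; move/eqP: c0.
rewrite mulf_eq0 prodf_seq_eq0 => /orP[/eqP ->|/hasP[j _]].
  by rewrite comp_mpoly0 mul0r.
by rewrite (negPf (bN0 j)) andbF.
Qed.

(** The denominator [b] divides a pulled-back polynomial, [w \mPo f = b * b'], so a / b has
    numerator [a * b'] over a denominator in the subfield, and this numerator is expanded in [e]. *)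
Lemma has_degree_fibre : has_degree f d.
Proof.
exists (fun i => (e i)%:F) => h.
have [a [b [b0 hE]]] := fraction_quotient h.
have [w [b' [w0 wE]]] := pullback_multiple b0.
have [u uE] := e_span (a * b').
have wf0 : w \mPo f != 0 by rewrite comp_mpoly_neq0.
have b'0 : b' != 0 by apply: contraNneq wf0; rewrite wE => ->; rewrite mulr0.
exists [ffun i => (u i \mPo f)%:F / (w \mPo f)%:F]; split.
  split=> [i|]; first by rewrite ffunE; exists (u i), w.
  under eq_bigr do rewrite ffunE mulrAC -rmorphM.
  rewrite -mulr_suml -rmorph_sum -uE wE !rmorphM hE /=.
  by rewrite -mulf_div divff ?mulr1 // tofrac_eq0.
move=> c [cL cE]; apply/ffunP => i; rewrite ffunE; apply/eqP.
rewrite eq_sym -subr_eq0; apply/eqP.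
pose g i := c i - (u i \mPo f)%:F / (w \mPo f)%:F.
apply: (@pullback_field_free g) => [j|].
  rewrite /g -mulN1r; apply: pullback_fieldD => //; apply: pullback_fieldM.
    by exists (-1), 1; rewrite comp_mpoly1 oner_eq0 !raddfN /= !rmorph1 divr1.
  by exists (u j), w.
rewrite /g; under eq_bigr do rewrite mulrBl mulrAC -rmorphM.
rewrite sumrB -mulr_suml -rmorph_sum -uE -cE wE !rmorphM hE /=.
by rewrite -mulf_div divff ?mulr1 ?subrr // tofrac_eq0.
Qed.

End DegreeFromFibre.

(** * Counting the points of fibres *)

Section FibreCardinality.
Variables (K : fieldType) (n : nat) (f : n.-tuple {mpoly K[n]}).

Lemma not_branch_locus y (T : finType) (P : T -> 'rV[K]_n) :
  degree f = #|T| -> injective P -> (forall t, polymap f (P t) = y) ->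
  ~ branch_locus f y.
Proof.
move=> degf Pinj fP [k]; rewrite degf ltnNge => /negP kT cardf; apply: kT.
pose Q (i : 'I_#|T|) := P (enum_val i).
have Qinj : {in [set: 'I_#|T|] &, injective Q}.
  by move=> i j _ _ /Pinj/enum_val_inj.
rewrite -card_le_II (card_le_eql card_II).
rewrite -(card_le_eql (inj_card_eq Qinj)) -(card_le_eqr cardf).
by apply: subset_card_le => _ [i _ <-]; exact: fP.
Qed.

(** The list serves twice: it makes the fibre finite, so that a cardinality [k] exists, and it
    bounds [k]. *)
Lemma mem_branch_locus y (s : seq 'rV[K]_n) :
  (forall v, polymap f v = y -> v \in s) -> (size (undup s) < degree f)%N ->
  branch_locus f y.
Proof.
move=> fs sf.
have sub : polymap f @^-1` [set y] `<=` [set` undup s].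
  by move=> v /fs; rewrite /= mem_undup.
have /finite_setP[k fk] := sub_finite_set sub (finite_seq _).
exists k => //; apply: leq_ltn_trans sf.
pose g := index^~ (undup s).
rewrite -card_le_II -(card_le_eql fk); apply: card_le_trans (subset_card_le sub) _.
have ginj : {in [set` undup s] &, injective g}.
  by move=> u v; rewrite !inE => us vs; exact: index_inj.
rewrite -(card_le_eql (inj_card_eq ginj)); apply: subset_card_le.
by move=> _ [v vs <-]; rewrite /= /g index_mem.
Qed.

End FibreCardinality.

(** * Roots of unity and Vieta's formulas *)

Lemma exists_prim_root (K : numClosedFieldType) n :
  (0 < n)%N -> exists z : K, n.-primitive_root z.
Proof.
pose p : {poly K} := 'X^n - 1; have [r Dp] := closed_field_poly_normal p => n0.
rewrite (monicP _) ?monicXnsubC // scale1r in Dp.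
have rn1 : all n.-unity_root r by apply/allP => z; rewrite -root_prod_XsubC -Dp.
have sz_r : (n < (size r).+1)%N.
  by rewrite -(size_prod_XsubC r id) -Dp size_XnsubC.
have [|z _ zP] := hasP (has_prim_root n0 rn1 _ sz_r); last by exists z.
by rewrite -separable_prod_XsubC -Dp separable_Xn_sub_1 // pnatr_eq0 -lt0n.
Qed.

Lemma monic_cubic_root (K : closedFieldType) (u v w : K) :
  exists x, x ^+ 3 = u * x ^+ 2 - v * x + w.
Proof.
have [x xE] := solve_monicpoly (fun i => [:: w; - v; u]`_i) (isT : (0 < 3)%N).
by exists x; rewrite xE !big_ord_recl big_ord0 /=; ring.
Qed.

Lemma monic_quadratic_root (K : closedFieldType) (u v : K) :
  exists x, x ^+ 2 = u * x - v.
Proof.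
have [x xE] := solve_monicpoly (fun i => [:: - v; u]`_i) (isT : (0 < 2)%N).
by exists x; rewrite xE !big_ord_recl big_ord0 /=; ring.
Qed.

Lemma viete_quadratic (K : closedFieldType) (u v : K) :
  exists a b, a + b = u /\ a * b = v.
Proof.
have [a aE] := monic_quadratic_root u v.
by exists a, (u - a); split; [ring | rewrite mulrBr -expr2 aE; ring].
Qed.

Lemma viete_cubic (K : closedFieldType) (u v w : K) :
  exists a b c, [/\ a + b + c = u, a * b + b * c + c * a = v & a * b * c = w].
Proof.
have [a aE] := monic_cubic_root u v w.
have [b [c [bc1 bc2]]] := viete_quadratic (u - a) (v - a * (u - a)).
have cE : c = u - a - b by rewrite -bc1; ring.
have bE : b * c = v - a * (u - a) by [].
exists a, b, c; split; first by rewrite cE; ring.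
  by rewrite bE cE; ring.
rewrite -mulrA bE; transitivity (a ^+ 3 - u * a ^+ 2 + v * a); first by ring.
by rewrite aE; ring.
Qed.

Lemma eq_sym_pair (K : fieldType) (a b a' b' : K) :
  a + b = a' + b' -> a * b = a' * b' ->
  (a' = a /\ b' = b) \/ (a' = b /\ b' = a).
Proof.
move=> s p; have /eqP : (a' - a) * (a' - b) = 0.
  transitivity (a' ^+ 2 - (a + b) * a' + a * b); first by ring.
  by rewrite s p; ring.
have b'E : b' = a + b - a' by rewrite s; ring.
rewrite mulf_eq0 !subr_eq0 b'E => /orP[] /eqP ->; [left|right]; split=> //; ring.
Qed.

(** [a'] is a root of the cubic with roots [a], [b], [c]; once it is matched with one of them, the
    remaining pairs have equal sums and products. *)
Lemma eq_sym_triple (K : fieldType) (a b c a' b' c' : K) :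
  a + b + c = a' + b' + c' ->
  a * b + b * c + c * a = a' * b' + b' * c' + c' * a' ->
  a * b * c = a' * b' * c' ->
  (a', b', c') \in
    [:: (a, b, c); (a, c, b); (b, a, c); (b, c, a); (c, a, b); (c, b, a)].
Proof.
move=> e1 e2 e3.
have rest x y z : x + y + z = a' + b' + c' ->
    x * y + y * z + z * x = a' * b' + b' * c' + c' * a' -> a' = x ->
    (b' = y /\ c' = z) \/ (b' = z /\ c' = y).
  move=> s1 s2 xE; rewrite xE in s1 s2.
  have s : y + z = b' + c' by apply: (addrI x); rewrite !addrA.
  apply: eq_sym_pair => //; apply: (addrI (x * (y + z))).
  rewrite {2}s; transitivity (x * y + y * z + z * x); first by ring.
  by rewrite s2; ring.
have /eqP : (a' - a) * (a' - b) * (a' - c) = 0.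
  transitivity (a' ^+ 3 - (a + b + c) * a' ^+ 2 + (a * b + b * c + c * a) * a'
                - a * b * c); first by ring.
  by rewrite e1 e2 e3; ring.
rewrite !mulf_eq0 !subr_eq0 -orbA !inE !xpair_eqE => /or3P[] /eqP a'E.
- by have [] := rest _ _ _ e1 e2 a'E => -[-> ->]; rewrite a'E !eqxx ?orbT.
- have s1 : b + a + c = a' + b' + c' by rewrite -e1; ring.
  have s2 : b * a + a * c + c * b = a' * b' + b' * c' + c' * a' by rewrite -e2; ring.
  by have [] := rest _ _ _ s1 s2 a'E => -[-> ->]; rewrite a'E !eqxx ?orbT.
- have s1 : c + a + b = a' + b' + c' by rewrite -e1; ring.
  have s2 : c * a + a * b + b * c = a' * b' + b' * c' + c' * a' by rewrite -e2; ring.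
  by have [] := rest _ _ _ s1 s2 a'E => -[-> ->]; rewrite a'E !eqxx ?orbT.
Qed.

(** * Points of the plane and the explicit maps *)

Section Plane.
Variable K : numClosedFieldType.

Definition pt (a b : K) : 'rV[K]_2 := \row_j [:: a; b]`_j.

Lemma pt_surj (v : 'rV[K]_2) : v = pt (v ord0 0) (v ord0 1).
Proof.
by apply/rowP => -[[|[|//]] i]; rewrite mxE /=; congr (v _ _); apply/val_inj.
Qed.

Lemma pt_inj a b a' b' : pt a b = pt a' b' -> a = a' /\ b = b'.
Proof. by move=> /rowP E; have := (E 0, E 1); rewrite !mxE /= => -[]. Qed.

(** A pair of equations rather than a conjunction, so that both act as one rewrite rule. *)
Lemma coords_pt a b : (coords (pt a b) 0 = a) * (coords (pt a b) 1 = b).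
Proof. by rewrite /coords !mxE. Qed.

Definition meval_arith :=
  (mevalD, mevalB, mevalN, mevalM, mevalXU, rmorphXn, rmorph_nat, meval1, coords_pt).

Lemma polymap2 (f1 f2 : {mpoly K[2]}) v :
  polymap [tuple f1; f2] v = pt f1.@[coords v] f2.@[coords v].
Proof.
apply/rowP => -[[|[|//]] i]; rewrite !mxE //=.
Qed.

Lemma C_C_pt a b : C_C K (pt a b) <-> a ^+ 3 = b ^+ 2.
Proof.
rewrite /C_C /zero_locus /= !meval_arith /=; split=> [/eqP|E].
  by rewrite subr_eq0 => /eqP.
by apply/eqP; rewrite subr_eq0; apply/eqP.
Qed.

Lemma C_D_pt a b : C_D K (pt a b) <-> a ^+ 2 + 18 * a - 8 * b - 27 = 0.
Proof.
by rewrite /C_D /zero_locus /= !meval_arith.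
Qed.

Lemma g2_pt a b : polymap (g2 K) (pt a b) =
  pt (4 * a + a ^+ 2 - 4 * b)
     (12 * a ^+ 2 - 8 * b - 6 * a * b + 2 * b ^+ 2 - a ^+ 3).
Proof. by rewrite polymap2 !meval_arith /=. Qed.

(* For an abstract morphism, because rewriting with [mevalM] in this expression
   is slow. *)
Lemma g3_rmorph (A B : comNzRingType) (phi : {rmorphism A -> B}) a b :
  (phi (9 - 18 * a + 9 * a ^+ 2 + a ^+ 3 + 6 * b - 6 * a * b) =
   9 - 18 * phi a + 9 * phi a ^+ 2 + phi a ^+ 3 + 6 * phi b - 6 * phi a * phi b) *
  (phi (9 * a ^+ 4 - 3 * a ^+ 3 * b - 36 * a ^+ 3 + 27 * a ^+ 2 * b
        + 81 * a ^+ 2 - 18 * a * b ^+ 2 - 54 * a * b - 81 * a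
        + 4 * b ^+ 3 + 18 * b ^+ 2 + 27 * b + 27) =
   9 * phi a ^+ 4 - 3 * phi a ^+ 3 * phi b - 36 * phi a ^+ 3
   + 27 * phi a ^+ 2 * phi b + 81 * phi a ^+ 2 - 18 * phi a * phi b ^+ 2
   - 54 * phi a * phi b - 81 * phi a + 4 * phi b ^+ 3 + 18 * phi b ^+ 2
   + 27 * phi b + 27).
Proof. by split; ring. Qed.

Lemma g3_pt a b : polymap (g3 K) (pt a b) =
  pt (9 - 18 * a + 9 * a ^+ 2 + a ^+ 3 + 6 * b - 6 * a * b)
     (9 * a ^+ 4 - 3 * a ^+ 3 * b - 36 * a ^+ 3 + 27 * a ^+ 2 * b
      + 81 * a ^+ 2 - 18 * a * b ^+ 2 - 54 * a * b - 81 * a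
      + 4 * b ^+ 3 + 18 * b ^+ 2 + 27 * b + 27).
Proof.
rewrite polymap2 !(g3_rmorph (meval (coords (pt a b)))) /= !mevalXU.
by rewrite !coords_pt.
Qed.

Lemma Ftilde_pt a b : polymap (Ftilde K) (pt a b) =
  pt (a ^+ 2 + b ^+ 2) (a ^+ 3 - 3 * a * b ^+ 2).
Proof. by rewrite polymap2 !meval_arith /=. Qed.

End Plane.

(** * The quotient of the torus by W *)

Section Torus.
Variable K : numClosedFieldType.
Implicit Types (a b u v : K) (w : K * K).

(** This is U, with c = (a b)^-1; V is [tsum a^-1 b^-1]. *)
Definition tsum a b := a + b + (a * b)^-1.

(** The permutations of (a, b, c), each recorded by its first two entries. In a list, positions name
    group elements even when points coincide. *)
Definition S3_orbit a b : seq (K * K) :=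
  [:: (a, b); (b, a); (a, (a * b)^-1); ((a * b)^-1, a);
      (b, (a * b)^-1); ((a * b)^-1, b)].

Definition W_orbit a b := S3_orbit a b ++ S3_orbit a^-1 b^-1.

Definition sym_pt u v : 'rV[K]_2 :=
  pt (3 + (u + v)) (9 / 2 + 3 * (u + v) + u * v / 2).

Definition torus_pt a b := sym_pt (tsum a b) (tsum a^-1 b^-1).

Lemma sym_ptC u v : sym_pt u v = sym_pt v u.
Proof. by rewrite /sym_pt (addrC u) (mulrC u). Qed.

Lemma sym_pt_eq u v u' v' : sym_pt u v = sym_pt u' v' ->
  (u' = u /\ v' = v) \/ (u' = v /\ v' = u).
Proof.
move=> /pt_inj[/addrI s]; rewrite s => /addrI.
move=> p; apply: eq_sym_pair => //; apply: (mulIf _ p).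
by rewrite invr_eq0 pnatr_eq0.
Qed.

Lemma S3_orbit_rmorph (phi : K -> K) a b : {morph phi : x y / x * y} ->
  {morph phi : x / x^-1} ->
  S3_orbit (phi a) (phi b) = [seq (phi w.1, phi w.2) | w <- S3_orbit a b].
Proof. by move=> phiM phiV; rewrite /S3_orbit /= !phiV !phiM. Qed.

Lemma W_orbit_exp d a b :
  W_orbit (a ^+ d) (b ^+ d) = [seq (w.1 ^+ d, w.2 ^+ d) | w <- W_orbit a b].
Proof.
rewrite map_cat -!(S3_orbit_rmorph (phi := fun x => x ^+ d)).
- by rewrite /W_orbit !exprVn.
- by move=> x y; rewrite exprMn.
- by move=> x; rewrite exprVn.
- by move=> x y; rewrite exprMn.
- by move=> x; rewrite exprVn.
Qed.

Lemma tsum_S3_orbit a b w : a != 0 -> b != 0 -> w \in S3_orbit a b ->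
  tsum w.1 w.2 = tsum a b /\ tsum w.1^-1 w.2^-1 = tsum a^-1 b^-1.
Proof.
move=> a0 b0; rewrite !inE /tsum.
by do !case/orP; move=> /eqP -> /=; split; field; rewrite ?a0 ?b0.
Qed.

Lemma torus_pt_orbit a b w : a != 0 -> b != 0 -> w \in W_orbit a b ->
  torus_pt w.1 w.2 = torus_pt a b.
Proof.
move=> a0 b0; rewrite mem_cat /torus_pt => /orP[] /tsum_S3_orbit.
  by case=> // -> ->.
by rewrite !invr_eq0 !invrK => -[] // -> ->; rewrite sym_ptC.
Qed.

(** As abc = 1, V is the second elementary symmetric function of (a, b, c), so U, V and 1 determine
    the triple up to order. *)
Lemma tsum_eq a b a' b' : a != 0 -> b != 0 -> a' != 0 -> b' != 0 ->
  tsum a' b' = tsum a b -> tsum a'^-1 b'^-1 = tsum a^-1 b^-1 ->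
  (a', b') \in S3_orbit a b.
Proof.
move=> a0 b0 a'0 b'0; rewrite /tsum -!invfM !invrK => e1 e2.
set c := (a * b)^-1 in e1 *; set c' := (a' * b')^-1 in e1.
have e2E (x y : K) : x != 0 -> y != 0 ->
    x * y + y * (x * y)^-1 + (x * y)^-1 * x = x^-1 + y^-1 + x * y.
  by move=> x0 y0; field; rewrite x0 y0.
have : (a', b', c') \in
    [:: (a, b, c); (a, c, b); (b, a, c); (b, c, a); (c, a, b); (c, b, a)].
  apply: eq_sym_triple; first by rewrite e1.
    by rewrite !e2E // e2.
  by rewrite !mulfV ?mulf_neq0.
rewrite /S3_orbit -/c !inE !xpair_eqE.
by do !case/orP; move=> /andP[-> _]; rewrite ?orbT.
Qed.

Lemma torus_pt_eq a b a' b' : a != 0 -> b != 0 -> a' != 0 -> b' != 0 ->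
  torus_pt a' b' = torus_pt a b -> (a', b') \in W_orbit a b.
Proof.
(* The exchange of U and V is the inversion on the torus. *)
move=> a0 b0 a'0 b'0 /sym_pt_eq; rewrite mem_cat => -[[U V]|[U V]].
  by rewrite tsum_eq.
by apply/orP; right; apply: tsum_eq; rewrite ?invr_eq0 ?invrK.
Qed.

Lemma torus_pt_surj (v : 'rV[K]_2) :
  exists a b, [/\ a != 0, b != 0 & torus_pt a b = v].
Proof.
rewrite (pt_surj v); move: (v ord0 0) (v ord0 1) => p q.
(* The formula of [sym_pt] is solved for U = s and V = t; then a, b, c are the roots of T^3 - s T^2
   + t T - 1. *)
have [s [t [st1 st2]]] := viete_quadratic (p - 3) (2 * (q - 9 / 2 - 3 * (p - 3))).
have [a [b [c [e1 e2 e3]]]] := viete_cubic s t 1.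
have : a * b * c != 0 by rewrite e3 oner_eq0.
rewrite !mulf_eq0 !negb_or => /andP[/andP[a0 b0] c0]; exists a, b; split=> //.
have cE : (a * b)^-1 = c.
  by apply: (mulfI (mulf_neq0 a0 b0)); rewrite e3 mulfV ?mulf_neq0.
have -> : torus_pt a b = sym_pt s t.
  rewrite /torus_pt /tsum cE e1 -invfM invrK -e2 -cE; congr sym_pt.
  by field; rewrite a0 b0.
rewrite /sym_pt st1 st2; congr pt; first by ring.
by field.
Qed.

Lemma C_D_torus_pt a b :
  C_D K (torus_pt a b) <-> tsum a b = tsum a^-1 b^-1.
Proof.
rewrite C_D_pt; set u := tsum a b; set v := tsum _ _.
have -> : (3 + (u + v)) ^+ 2 + 18 * (3 + (u + v)) -
    8 * (9 / 2 + 3 * (u + v) + u * v / 2) - 27 = (u - v) ^+ 2 by field.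
by split=> [/eqP|->]; rewrite ?subrr ?expr0n // sqrf_eq0 subr_eq0 => /eqP.
Qed.

Lemma C_C_torus_pt a b : a != 0 -> b != 0 ->
  C_C K (torus_pt a b) <-> [\/ a = b, b = (a * b)^-1 | a = (a * b)^-1].
Proof.
move=> a0 b0; rewrite C_C_pt; set p := 3 + _; set q := 9 / 2 + _ + _.
set c := (a * b)^-1.
have E : - 4 * (p ^+ 3 - q ^+ 2) = ((a - b) * (b - c) * (a - c)) ^+ 2.
  by rewrite /p /q /c /tsum; field; rewrite a0 b0.
split=> [pq|abc].
  move: E; rewrite pq subrr mulr0 => /esym/eqP.
  rewrite sqrf_eq0 !mulf_eq0 !subr_eq0 -orbA => /or3P[] /eqP; first by constructor 1.
    by constructor 2.
  by constructor 3.
have : - 4 * (p ^+ 3 - q ^+ 2) = 0.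
  by rewrite E; case: abc => ->; rewrite subrr ?mulr0 ?mul0r expr0n.
move/eqP; rewrite mulf_eq0 oppr_eq0 pnatr_eq0 /= subr_eq0.
by move/eqP.
Qed.

(** Positions 6 to 11 involve the inversion, and a fixed point there has U = V; positions 1 to 5
    force two of a, b, c to agree. Position 0 is the identity. *)
Lemma regular_W_orbit a b w k : a != 0 -> b != 0 ->
  ~ C_C K (torus_pt a b) -> ~ C_D K (torus_pt a b) ->
  (k < 12)%N -> nth w (W_orbit a b) k = (a, b) -> k = 0.
Proof.
move=> a0 b0 nC nD k12 kE.
have nS3 : (a, b) \notin S3_orbit a^-1 b^-1.
  apply/negP => /tsum_S3_orbit; rewrite !invr_eq0 !invrK => -[] // E _.
  by apply: nD; apply/C_D_torus_pt.
have k6 : (k < 6)%N.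
  rewrite ltnNge; apply: contra nS3 => k6; rewrite -kE nth_cat /= ltnNge k6 /=.
  by apply: mem_nth; rewrite ltn_subLR.
move: kE; rewrite nth_cat k6.
case: k k6 {k12} => [//|[|[|[|[|[|//]]]]]] _ /= /eqP;
  rewrite xpair_eqE => /andP[/eqP E1 /eqP E2]; case: nC; apply/C_C_torus_pt => //.
- by constructor 1.
- by constructor 2.
- by constructor 3.
- by constructor 1.
- by constructor 3.
Qed.

Lemma prim_root_neq0 d (z : K) : d.-primitive_root z -> z != 0.
Proof.
move=> zP; apply: contraTneq (oner_neq0 K) => z0.
by rewrite -(prim_expr_order zP) z0 expr0n eqn0Ngt (prim_order_gt0 zP) eqxx.
Qed.

(** * Fibres and branching of a power map *)

Section PowerMap.
Variables (d : nat) (f : 2.-tuple {mpoly K[2]}).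
Hypothesis d_gt1 : (1 < d)%N.
Hypothesis f_torus_pt : forall a b, a != 0 -> b != 0 ->
  polymap f (torus_pt a b) = torus_pt (a ^+ d) (b ^+ d).

Lemma fibre_torus_pt z a b (v : 'rV[K]_2) : a != 0 -> b != 0 -> d.-primitive_root z ->
  polymap f v = torus_pt (a ^+ d) (b ^+ d) ->
  exists i j : 'I_d, v = torus_pt (z ^+ i * a) (z ^+ j * b).
Proof.
move=> a0 b0 zP; have [a' [b' [a'0 b'0 <-]]] := torus_pt_surj v.
rewrite f_torus_pt // => /esym/torus_pt_eq; rewrite !expf_neq0 // => /(_ isT isT isT isT).
rewrite W_orbit_exp => /mapP[w wO [aE bE]].
(* The point [w] represents the same [v] as (a', b') and has the same d-th powers as (a, b), so it
   differs from (a, b) by roots of unity. *)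
rewrite -(torus_pt_orbit a'0 b'0 wO).
have root x y : x != 0 -> x ^+ d = y ^+ d -> exists i : 'I_d, y = z ^+ i * x.
  move=> x0 xy; have [|i iE] := @prim_rootP _ _ _ zP (y / x).
    by rewrite expr_div_n -xy mulfV // expf_neq0.
  by exists i; rewrite -iE divfK.
have [i ->] := root _ _ a0 aE; have [j ->] := root _ _ b0 bE.
by exists i, j.
Qed.

Lemma torus_pt_root (y : 'rV[K]_2) : exists a b,
  [/\ a != 0, b != 0 & torus_pt (a ^+ d) (b ^+ d) = y].
Proof.
have d0 : (0 < d)%N := ltnW d_gt1.
have [a [b [a0 b0 <-]]] := torus_pt_surj y.
exists (d.-root a), (d.-root b).
by rewrite !rootCK // !rootC_eq0.
Qed.

Definition root_pt z a b (ij : 'I_d * 'I_d) :=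
  torus_pt (z ^+ ij.1 * a) (z ^+ ij.2 * b).

Lemma f_root_pt z a b ij : d.-primitive_root z -> a != 0 -> b != 0 ->
  polymap f (root_pt z a b ij) = torus_pt (a ^+ d) (b ^+ d).
Proof.
move=> zP a0 b0; have z0 := prim_root_neq0 zP.
rewrite f_torus_pt ?mulf_neq0 ?expf_neq0 // !exprMn.
by rewrite !(exprAC _ _ d) !(prim_expr_order zP) !expr1n !mul1r.
Qed.

Lemma fibre_off_branch (y : 'rV[K]_2) : ~ C_C K y -> ~ C_D K y ->
  exists P : 'I_d * 'I_d -> 'rV[K]_2,
    injective P /\ forall ij, polymap f (P ij) = y.
Proof.
have [a [b [a0 b0 <-]]] := torus_pt_root y => nC nD.
have [z zP] := exists_prim_root K (ltnW d_gt1); have z0 := prim_root_neq0 zP.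
exists (root_pt z a b); split=> [[i j] [i' j']|ij]; last exact: f_root_pt.
have nz k x : x != 0 -> z ^+ k * x != 0 by move=> x0; rewrite mulf_neq0 ?expf_neq0.
move=> /torus_pt_eq; rewrite !nz // => /(_ isT isT isT isT) /= /(nthP (0, 0))[k].
rewrite [size _]/= => k12 kE.
have zd (l : nat) x : (z ^+ l * x) ^+ d = x ^+ d.
  by rewrite exprMn exprAC (prim_expr_order zP) expr1n mul1r.
(* Powers commute with W, so the element at position [k] fixes (a^d, b^d). *)
have k0 : k = 0.
  apply: (regular_W_orbit (w := (0 ^+ d, 0 ^+ d)) _ _ nC nD k12);
    rewrite ?expf_neq0 //.
  rewrite -{1}(zd i' a) -{1}(zd j' b) W_orbit_exp (nth_map (0, 0)) // kE /=.
  by rewrite !zd.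
move: kE; rewrite k0 /= => -[] /(mulIf a0)/eqP + /(mulIf b0)/eqP.
rewrite !(eq_prim_root_expr zP) !modn_small // => /eqP/val_inj -> /eqP/val_inj ->.
by [].
Qed.

(** Assumed only from here on, since [fibre_off_branch] is itself used to compute the degrees. *)
Hypothesis f_degree : degree f = (d * d)%N.

(** The d^2 root points exhaust the fibre, and a repetition leaves fewer than d^2 of them. *)
Lemma root_pt_branch z a b : d.-primitive_root z -> a != 0 -> b != 0 ->
  ~ injective (root_pt z a b) -> branch_locus f (torus_pt (a ^+ d) (b ^+ d)).
Proof.
move=> zP a0 b0 ninj; apply: (mem_branch_locus (s := codom (root_pt z a b))).
  move=> v /(fibre_torus_pt a0 b0 zP)[i [j ->]].
  by apply/codomP; exists (i, j).
rewrite f_degree -[X in (X * X)%N]card_ord -card_prod -(size_codom (root_pt z a b)).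
by rewrite ltn_size_undup; apply/negP => /injectiveP.
Qed.

Lemma branch_locus_power_map : branch_locus f = C_C K `|` C_D K.
Proof.
apply/seteqP; split=> [y yB|y].
  apply: contrapT => /not_orP[nC nD].
  have [P [Pinj fP]] := fibre_off_branch nC nD.
  by apply: not_branch_locus Pinj fP yB; rewrite card_prod card_ord.
have [z zP] := exists_prim_root K (ltnW d_gt1); have z0 := prim_root_neq0 zP.
have [e dE] : exists e, d = e.+2 by case: d d_gt1 => [|[|e]] // _; exists e.
pose o0 : 'I_d := Ordinal (ltnW d_gt1); pose o1 : 'I_d := Ordinal d_gt1.
have le : (d.-1 < d)%N by rewrite dE.
(* Exponents range over ['I_d], so z^-1 has to be written as a natural power of z. *)
have ze : z ^+ d.-1 = z^-1.
  by apply: (mulfI z0); rewrite mulfV // -exprS prednK ?(prim_expr_order zP) ?dE.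
case.
  (* With a^d = x, the points (a, z a) and (z a, a) over (x, x) are exchanged by a transposition. *)
  have diag x : x != 0 -> branch_locus f (torus_pt x x).
    move=> x0; pose a := d.-root x.
    have a0 : a != 0 by rewrite rootC_eq0 // ltnW.
    have aE : a ^+ d = x by rewrite rootCK // ltnW.
    rewrite -aE; apply: (root_pt_branch zP) => // inj.
    have /inj[] : root_pt z a a (o0, o1) = root_pt z a a (o1, o0).
      apply: (torus_pt_orbit (w := (_, _))); rewrite ?mulf_neq0 ?expf_neq0 //.
      by rewrite !inE eqxx orbT.
    by [].
  have [a [b [a0 b0 <-]]] := torus_pt_surj y => /(C_C_torus_pt a0 b0).
  (* W carries the cases b = c and a = c to the diagonal. *)
  have orb w : w \in S3_orbit a b -> torus_pt a b = torus_pt w.1 w.2.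
    by move=> wO; apply/esym/torus_pt_orbit => //; rewrite mem_cat wO.
  case=> E.
  - by rewrite -E; apply: diag.
  - by rewrite (orb (b, (a * b)^-1)) ?inE ?eqxx ?orbT //= -E; apply: diag.
  - by rewrite (orb (a, (a * b)^-1)) ?inE ?eqxx ?orbT //= -E; apply: diag.
have [a [b [a0 b0 <-]]] := torus_pt_surj y => /C_D_torus_pt.
rewrite /torus_pt => <-; set u := tsum a b.
(* When U = V = u there is a representative (x, x^-1) with third entry 1: the quadratic is x + x^-1
   + 1 = u. *)
have [x xE] := monic_quadratic_root (u - 1) 1.
have x0 : x != 0.
  by apply: contra_eq_neq xE => ->; rewrite mulr0 add0r expr0n eq_sym oppr_eq0 oner_eq0.
have uE : tsum x x^-1 = u.
  rewrite /tsum mulfV // invr1; apply: (mulfI x0).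
  by transitivity (x ^+ 2 + 1 + x); [field | rewrite xE; ring].
have -> : sym_pt u u = torus_pt x x^-1.
  rewrite /torus_pt invrK uE; congr sym_pt.
  by rewrite -uE /tsum mulVf // mulfV // (addrC x).
pose w := d.-root x; have w0 : w != 0 by rewrite rootC_eq0 // ltnW.
have wE : w ^+ d = x by rewrite rootCK // ltnW.
rewrite -wE -exprVn; apply: (root_pt_branch zP); rewrite ?invr_eq0 // => inj.
(* Inverting (w, (z w)^-1) and exchanging the entries gives (z w, w^-1), so two root points
   collide. *)
have /inj[] : root_pt z w w^-1 (o0, Ordinal le) = root_pt z w w^-1 (o1, o0).
  change (torus_pt (z ^+ 0 * w) (z ^+ d.-1 / w) = torus_pt (z ^+ 1 * w) (z ^+ 0 / w)).
  rewrite expr0 expr1 !mul1r ze -invfM.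
  apply: (torus_pt_orbit (w := (w, (z * w)^-1)));
    rewrite ?mulf_neq0 ?invr_eq0 //.
  by rewrite mem_cat orbC !inE invrK eqxx orbT.
by rewrite dE.
Qed.

End PowerMap.
End Torus.

(** * Degrees of the three maps *)

Lemma enum_family (T : finType) (S : Type) d (P : T -> S) :
  #|T| = d -> injective P -> exists Q : 'I_d -> S,
    injective Q /\ forall i, exists t, Q i = P t.
Proof.
move=> <- Pinj; exists (fun i => P (enum_val i)); split=> [i j|i].
  by move=> /Pinj/enum_val_inj.
by exists (enum_val i).
Qed.

Section Degrees.
Variable K : numClosedFieldType.
Local Notation X := ('X_0 : {mpoly K[2]}).
Local Notation Y := ('X_1 : {mpoly K[2]}).

Lemma degree_pt_fibre d (f : 2.-tuple {mpoly K[2]}) (e : 'I_d -> {mpoly K[2]})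
    (T : finType) :
  #|T| = d -> (forall h, pullback_span f e h) ->
  (forall y, ~ C_C K y -> ~ C_D K y ->
    exists P : T -> 'rV[K]_2, injective P /\ forall t, polymap f (P t) = y) ->
  degree f = d.
Proof.
move=> cT e_span fib; apply: degreeE.
pose D : {mpoly K[2]} :=
  (X ^+ 3 - Y ^+ 2) * (X ^+ 2 + 18 * X - 8 * Y - 27).
apply: (has_degree_fibre e_span (D := D)) => [|y].
  (* At (0, 1) the two factors of [D] are -1 and -35. *)
  apply/eqP => D0; have : D.@[coords (pt 0 1)] = 0 by rewrite D0 meval0.
  rewrite /D !meval_arith /= (_ : _ * _ = 35); last by ring.
  by move/eqP; rewrite pnatr_eq0.
rewrite mevalM mulf_eq0 negb_or => /andP[/eqP nC /eqP nD].
have [P [Pinj fP]] := fib y nC nD.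
have [Q [Qinj QP]] := enum_family cT Pinj.
by exists Q; split=> // j; have [t ->] := QP j.
Qed.

Definition monomial i j : {mpoly K[2]} := X ^+ i * Y ^+ j.

(** One index k = j * a + i encodes X^i Y^j with i < a and j < b, as [has_degree] wants a basis
    indexed by an ordinal. *)
Definition monomial_basis a b (i : 'I_(a * b)) := monomial (i %% a) (i %/ a).
Arguments monomial_basis : clear implicits.

Section MonomialSpan.
Variables (a b : nat) (f1 f2 : {mpoly K[2]}).
Local Notation S := (pullback_span [tuple f1; f2] (monomial_basis a b)).

Lemma monomial_span_basis i j : (i < a)%N -> (j < b)%N -> S (monomial i j).
Proof.
move=> ia jb; have a0 : (0 < a)%N by apply: leq_ltn_trans ia.
have ij : (j * a + i < a * b)%N.
  by rewrite mulnC -ltn_subRL -mulnBr (leq_trans ia) // leq_pmulr // subn_gt0.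
have := pullback_span_basis [tuple f1; f2] (monomial_basis a b) (Ordinal ij).
by rewrite /monomial_basis /= modnMDl modn_small // divnMDl // divn_small ?addn0.
Qed.

Lemma pullback_span_fst h : S h -> S (f1 * h).
Proof. exact: (@pullback_span_tnth _ _ _ _ _ _ 0). Qed.

Lemma pullback_span_snd h : S h -> S (f2 * h).
Proof. exact: (@pullback_span_tnth _ _ _ _ _ _ 1). Qed.

Lemma pullback_span_natl k h : S h -> S (k%:R * h).
Proof. by move=> Sh; rewrite -mpolyC_nat mul_mpolyC; apply: pullback_spanZ. Qed.

(** Cancels the integer leading coefficients of the reductions below, by characteristic 0. *)
Lemma pullback_span_natl_inv k h : S (k.+1%:R * h) -> S h.
Proof.
move=> /(pullback_spanZ k.+1%:R^-1); rewrite -mpolyC_nat mul_mpolyC scalerA.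
by rewrite mulVf ?pnatr_eq0 // scale1r.
Qed.

(** A variable times a monomial of the box stays in the box or lands on X^a Y^j or X^i Y^b. *)
Lemma monomial_span_full : (0 < a)%N -> (0 < b)%N ->
  (forall j, (j < b)%N -> S (monomial a j)) ->
  (forall i, (i < a)%N -> S (monomial i b)) -> forall h, S h.
Proof.
move=> a0 b0 Sa Sb; apply: pullback_span_full => [|k i].
  by have := monomial_span_basis a0 b0; rewrite /monomial mulr1.
have ia : (i %% a < a)%N by rewrite ltn_mod.
have ib : (i %/ a < b)%N by rewrite ltn_divLR // [leqRHS]mulnC.
case: k => -[|[|//]] k2; rewrite /monomial_basis.
  rewrite (_ : 'X_ _ * _ = monomial (i %% a).+1 (i %/ a)).
    move: ia; rewrite leq_eqVlt => /predU1P[->|ia]; first exact: Sa.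
    exact: monomial_span_basis.
  by rewrite /monomial exprS -mulrA; congr ('X_ _ * _); apply/val_inj.
rewrite (_ : 'X_ _ * _ = monomial (i %% a) (i %/ a).+1).
  move: ib; rewrite leq_eqVlt => /predU1P[->|ib]; first exact: Sb.
  exact: monomial_span_basis.
by rewrite /monomial exprS mulrCA; congr (_ * ('X_ _ * _)); apply/val_inj.
Qed.

End MonomialSpan.

(* Purely syntactic, because unification of a monomial with one of the defining
   polynomials of a map is very slow. *)
Ltac span multiple := repeat lazymatch goal with
  | |- pullback_span _ _ (_ - _) => apply: pullback_spanB
  | |- pullback_span _ _ (_ + _) => apply: pullback_spanD
  | |- pullback_span _ _ (_%:R * _) => apply: pullback_span_natl
  | |- pullback_span _ _ (_ ^+ _ * _ ^+ _) => assumption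
  | |- pullback_span _ _ (_ * _) => apply: multiple
  end.

Lemma g2_reduce_fst (A : comNzRingType) (x y : A) i j :
  x ^+ i.+2 * y ^+ j = (4 * x + x ^+ 2 - 4 * y) * (x ^+ i * y ^+ j)
    - 4%:R * (x ^+ i.+1 * y ^+ j) + 4%:R * (x ^+ i * y ^+ j.+1).
Proof. by rewrite !exprS; ring. Qed.

Lemma g2_reduce_snd (A : comNzRingType) (x y : A) i j :
  2%:R * (x ^+ i * y ^+ j.+2) =
    (12 * x ^+ 2 - 8 * y - 6 * x * y + 2 * y ^+ 2 - x ^+ 3) * (x ^+ i * y ^+ j)
    - 12%:R * (x ^+ i.+2 * y ^+ j) + 8%:R * (x ^+ i * y ^+ j.+1)
    + 6%:R * (x ^+ i.+1 * y ^+ j.+1) + x ^+ i.+3 * y ^+ j.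
Proof. by rewrite !exprS; ring. Qed.

Lemma g2_span h : pullback_span (g2 K) (@monomial_basis 2 2) h.
Proof.
pose M i j := pullback_span (g2 K) (@monomial_basis 2 2) (monomial i j).
have bas i j : (i < 2)%N -> (j < 2)%N -> M i j := @monomial_span_basis _ _ _ _ i j.
have red1 i j : M i j -> M i.+1 j -> M i j.+1 -> M i.+2 j.
  by rewrite /M => *; rewrite [monomial i.+2 j]g2_reduce_fst; span pullback_span_fst.
have red2 i j : M i j -> M i.+2 j -> M i j.+1 -> M i.+1 j.+1 -> M i.+3 j -> M i j.+2.
  rewrite /M => *; apply: (@pullback_span_natl_inv _ _ _ _ 1).
  by rewrite [_ * monomial i j.+2]g2_reduce_snd; span pullback_span_snd.
(* Each reduction uses only monomials already reached; x^3 and x^4 are auxiliary, for y^2 and x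
   y^2. *)
have m00 := bas 0 0 isT isT; have m10 := bas 1 0 isT isT.
have m01 := bas 0 1 isT isT; have m11 := bas 1 1 isT isT.
have m20 := red1 _ _ m00 m10 m01; have m30 := red1 _ _ m10 m20 m11.
have m02 := red2 _ _ m00 m20 m01 m11 m30; have m21 := red1 _ _ m01 m11 m02.
have m40 := red1 _ _ m20 m30 m21; have m12 := red2 _ _ m10 m30 m11 m21 m40.
by apply: monomial_span_full => //; case=> [|[|//]] _.
Qed.

Lemma g3_reduce_fst (A : comNzRingType) (x y : A) i j :
  x ^+ i.+3 * y ^+ j =
    (9 - 18 * x + 9 * x ^+ 2 + x ^+ 3 + 6 * y - 6 * x * y) * (x ^+ i * y ^+ j)
    - 9%:R * (x ^+ i * y ^+ j) + 18%:R * (x ^+ i.+1 * y ^+ j)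
    - 9%:R * (x ^+ i.+2 * y ^+ j) - 6%:R * (x ^+ i * y ^+ j.+1)
    + 6%:R * (x ^+ i.+1 * y ^+ j.+1).
Proof. by rewrite !exprS; ring. Qed.

Lemma g3_reduce_snd (A : comNzRingType) (x y : A) i :
  4%:R * (x ^+ i * y ^+ 3) =
    (9 * x ^+ 4 - 3 * x ^+ 3 * y - 36 * x ^+ 3 + 27 * x ^+ 2 * y
      + 81 * x ^+ 2 - 18 * x * y ^+ 2 - 54 * x * y - 81 * x
      + 4 * y ^+ 3 + 18 * y ^+ 2 + 27 * y + 27) * (x ^+ i * y ^+ 0)
    - 9%:R * (x ^+ i.+4 * y ^+ 0) + 3%:R * (x ^+ i.+3 * y ^+ 1)
    + 36%:R * (x ^+ i.+3 * y ^+ 0) - 27%:R * (x ^+ i.+2 * y ^+ 1)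
    - 81%:R * (x ^+ i.+2 * y ^+ 0) + 18%:R * (x ^+ i.+1 * y ^+ 2)
    + 54%:R * (x ^+ i.+1 * y ^+ 1) + 81%:R * (x ^+ i.+1 * y ^+ 0)
    - 18%:R * (x ^+ i * y ^+ 2) - 27%:R * (x ^+ i * y ^+ 1)
    - 27%:R * (x ^+ i * y ^+ 0).
Proof. by rewrite !exprS; ring. Qed.

Lemma g3_span h : pullback_span (g3 K) (@monomial_basis 3 3) h.
Proof.
pose M i j := pullback_span (g3 K) (@monomial_basis 3 3) (monomial i j).
have bas i j : (i < 3)%N -> (j < 3)%N -> M i j := @monomial_span_basis _ _ _ _ i j.
have red1 i j : M i j -> M i.+1 j -> M i.+2 j -> M i j.+1 -> M i.+1 j.+1 -> M i.+3 j.
  by rewrite /M => *; rewrite [monomial i.+3 j]g3_reduce_fst; span pullback_span_fst.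
have red2 i : M i 0 -> M i.+1 0 -> M i.+2 0 -> M i.+3 0 -> M i.+4 0 ->
    M i 1 -> M i.+1 1 -> M i.+2 1 -> M i.+3 1 -> M i 2 -> M i.+1 2 -> M i 3.
  rewrite /M => *; apply: (@pullback_span_natl_inv _ _ _ _ 3).
  by rewrite [_ * monomial i 3]g3_reduce_snd; span pullback_span_snd.
(* Same climb: y^3, x y^3 and x^2 y^3 require x^4, x^5 and x^6 respectively. *)
have m00 := bas 0 0 isT isT; have m10 := bas 1 0 isT isT; have m20 := bas 2 0 isT isT.
have m01 := bas 0 1 isT isT; have m11 := bas 1 1 isT isT; have m21 := bas 2 1 isT isT.
have m02 := bas 0 2 isT isT; have m12 := bas 1 2 isT isT; have m22 := bas 2 2 isT isT.
have m30 : M 3 0 by apply: red1.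
have m31 : M 3 1 by apply: red1.
have m40 : M 4 0 by apply: red1.
have m03 : M 0 3 by apply: red2.
have m50 : M 5 0 by apply: red1.
have m41 : M 4 1 by apply: red1.
have m13 : M 1 3 by apply: red2.
have m32 : M 3 2 by apply: red1.
have m60 : M 6 0 by apply: red1.
have m51 : M 5 1 by apply: red1.
have m23 : M 2 3 by apply: red2.
by apply: monomial_span_full => //; case=> [|[|[|//]]] _.
Qed.

Lemma Ftilde_reduce_fst (A : comNzRingType) (x y : A) i j :
  x ^+ i * y ^+ j.+2 = (x ^+ 2 + y ^+ 2) * (x ^+ i * y ^+ j) - x ^+ i.+2 * y ^+ j.
Proof. by rewrite !exprS; ring. Qed.

(** Substituting y^2 = p - x^2 in q leaves 4 x^3 = q + 3 p x, the cubic that also describes the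
    fibres of [Ftilde]. *)
Lemma Ftilde_reduce_snd (A : comNzRingType) (x y : A) i j :
  4%:R * (x ^+ i.+3 * y ^+ j) = (x ^+ 3 - 3 * x * y ^+ 2) * (x ^+ i * y ^+ j)
    + 3%:R * ((x ^+ 2 + y ^+ 2) * (x ^+ i.+1 * y ^+ j)).
Proof. by rewrite !exprS; ring. Qed.

Lemma Ftilde_span h : pullback_span (Ftilde K) (@monomial_basis 3 2) h.
Proof.
pose M i j := pullback_span (Ftilde K) (@monomial_basis 3 2) (monomial i j).
have bas i j : (i < 3)%N -> (j < 2)%N -> M i j := @monomial_span_basis _ _ _ _ i j.
have red1 i j : M i j -> M i.+2 j -> M i j.+2.
  by rewrite /M => *; rewrite [monomial i j.+2]Ftilde_reduce_fst; span pullback_span_fst.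
have red2 i j : M i j -> M i.+1 j -> M i.+3 j.
  rewrite /M => *; apply: (@pullback_span_natl_inv _ _ _ _ 3).
  rewrite [_ * monomial i.+3 j]Ftilde_reduce_snd; apply: pullback_spanD.
    by span pullback_span_snd.
  by span pullback_span_fst.
have m00 := bas 0 0 isT isT; have m10 := bas 1 0 isT isT; have m20 := bas 2 0 isT isT.
have m01 := bas 0 1 isT isT; have m11 := bas 1 1 isT isT; have m21 := bas 2 1 isT isT.
have m30 := red2 _ _ m00 m10; have m31 := red2 _ _ m01 m11.
have m40 := red2 _ _ m10 m20.
have m02 := red1 _ _ m00 m20; have m12 := red1 _ _ m10 m30.
have m22 := red1 _ _ m20 m40.
apply: monomial_span_full => //; first by case=> [|[|//]] _.
by case=> [|[|[|//]]] _.
Qed.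

End Degrees.

(** * The three branch loci *)

Section BranchLoci.
Variable K : numClosedFieldType.
Implicit Types a b u v : K.

(** Newton's identity for the second power sum, with elementary symmetric functions U, V and 1. *)
Lemma tsum_sqr a b : a != 0 -> b != 0 ->
  tsum (a ^+ 2) (b ^+ 2) = tsum a b ^+ 2 - 2 * tsum a^-1 b^-1.
Proof. by move=> a0 b0; rewrite /tsum; field; rewrite a0 b0. Qed.

(** Newton's identity for the third power sum; the final 3 is 3abc. *)
Lemma tsum_cube a b : a != 0 -> b != 0 ->
  tsum (a ^+ 3) (b ^+ 3) =
    tsum a b ^+ 3 - 3 * tsum a b * tsum a^-1 b^-1 + 3.
Proof. by move=> a0 b0; rewrite /tsum; field; rewrite a0 b0. Qed.

Lemma g2_sym_pt u v :
  polymap (g2 K) (sym_pt u v) = sym_pt (u ^+ 2 - 2 * v) (v ^+ 2 - 2 * u).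
Proof. by rewrite g2_pt /sym_pt; congr pt; field. Qed.

Lemma g3_sym_pt u v : polymap (g3 K) (sym_pt u v) =
  sym_pt (u ^+ 3 - 3 * u * v + 3) (v ^+ 3 - 3 * u * v + 3).
Proof. by rewrite g3_pt /sym_pt; congr pt; field. Qed.

Lemma g2_torus_pt a b : a != 0 -> b != 0 ->
  polymap (g2 K) (torus_pt a b) = torus_pt (a ^+ 2) (b ^+ 2).
Proof.
move=> a0 b0; rewrite g2_sym_pt /torus_pt -!exprVn !tsum_sqr ?invr_eq0 //.
by rewrite !invrK.
Qed.

Lemma g3_torus_pt a b : a != 0 -> b != 0 ->
  polymap (g3 K) (torus_pt a b) = torus_pt (a ^+ 3) (b ^+ 3).
Proof.
move=> a0 b0; rewrite g3_sym_pt /torus_pt -!exprVn !tsum_cube ?invr_eq0 //.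
by rewrite !invrK (mulrAC 3 (tsum a^-1 _)).
Qed.

Lemma degree_g2 : degree (g2 K) = 4.
Proof.
apply: (degree_pt_fibre (T := ('I_2 * 'I_2)%type) _ (@g2_span K)).
  by rewrite card_prod !card_ord.
exact: (fibre_off_branch (d := 2) isT g2_torus_pt).
Qed.

Lemma degree_g3 : degree (g3 K) = 9.
Proof.
apply: (degree_pt_fibre (T := ('I_3 * 'I_3)%type) _ (@g3_span K)).
  by rewrite card_prod !card_ord.
exact: (fibre_off_branch (d := 3) isT g3_torus_pt).
Qed.

(** x runs through the roots of 4 x^3 - 3 p x - q and y through the square roots of p - x^2; off C_C
    these are three and two. *)
Lemma Ftilde_fibre_off_branch (y : 'rV[K]_2) : ~ C_C K y ->
  exists P : 'I_3 * bool -> 'rV[K]_2,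
    injective P /\ forall t, polymap (Ftilde K) (P t) = y.
Proof.
rewrite (pt_surj y); move: (y ord0 0) (y ord0 1) => p q nC.
have pq : p ^+ 3 != q ^+ 2 by apply/eqP => /C_C_pt.
have [x1 [x2 [x3 [e1 e2 e3]]]] := viete_cubic 0 (- 3 * p / 4) (q / 4).
have root x : x \in [:: x1; x2; x3] -> 4 * x ^+ 3 - 3 * p * x - q = 0.
  have E : 4 * x ^+ 3 - 3 * p * x - q = 4 * ((x - x1) * (x - x2) * (x - x3)).
    transitivity (4 * (x ^+ 3 - (x1 + x2 + x3) * x ^+ 2
      + (x1 * x2 + x2 * x3 + x3 * x1) * x - x1 * x2 * x3)); last by ring.
    by rewrite e1 e2 e3; field.
  rewrite E !inE.
  by case/or3P => /eqP ->; rewrite subrr ?mulr0 ?mul0r ?mulr0.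
(* A double root a forces p = 4 a^2 and q = -8 a^3, hence p^3 = q^2. *)
have double a b c : a + b + c = 0 -> a * b + b * c + c * a = - 3 * p / 4 ->
    a * b * c = q / 4 -> a != b.
  move=> s1 s2 s3; apply: contra_neq pq => ab; rewrite -{b}ab in s1 s2 s3.
  have cE : c = - 2 * a by apply/eqP; rewrite -subr_eq0 -s1; apply/eqP; ring.
  have pE : p = 4 * a ^+ 2.
    transitivity (- (4 / 3) * (- 3 * p / 4)); first by field.
    by rewrite -s2 cE; field.
  have qE : q = - 8 * a ^+ 3.
    transitivity (4 * (q / 4)); first by field.
    by rewrite -s3 cE; ring.
  by rewrite pE qE; ring.
have x12 : x1 != x2 := double _ _ _ e1 e2 e3.
have x23 : x2 != x3 by apply: (double _ _ x1); rewrite -?e1 -?e2 -?e3; ring.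
have x31 : x3 != x1 by apply: (double _ _ x2); rewrite -?e1 -?e2 -?e3; ring.
pose xs := [:: x1; x2; x3].
have xsP (i : 'I_3) : xs`_i \in xs by apply: mem_nth.
have xsU : uniq xs by rewrite /= !inE negb_or x12 x23 eq_sym x31.
pose r (i : 'I_3) := sqrtC (p - xs`_i ^+ 2).
have rE i : r i ^+ 2 = p - xs`_i ^+ 2 by rewrite sqrtCK.
(* If x^2 = p, the cubic becomes x^3 = q, and again p^3 = q^2. *)
have r0 i : r i != 0.
  rewrite -sqrf_eq0 rE subr_eq0; apply: contra_neq pq => pE.
  have := root _ (xsP i); rewrite pE => /eqP.
  rewrite (_ : _ - q = xs`_i ^+ 3 - q); last by ring.
  by rewrite subr_eq0 => /eqP <-; ring.
exists (fun t : 'I_3 * bool => pt xs`_t.1 ((-1) ^+ t.2 * r t.1)).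
split=> [[i s] [j s']|[i s]] /=.
  move=> /pt_inj[/eqP]; rewrite nth_uniq // => /eqP/val_inj ->.
  move=> /(mulIf (r0 j)); case: s s' => -[] //; rewrite expr0 expr1 => /eqP.
    by rewrite eqNr oner_eq0.
  by rewrite eq_sym eqNr oner_eq0.
rewrite Ftilde_pt exprMn sqrr_sign mul1r rE addrC subrK; congr pt.
apply/eqP; rewrite -subr_eq0; apply/eqP.
by rewrite -[RHS](root _ (xsP i)); ring.
Qed.

Lemma degree_Ftilde : degree (Ftilde K) = 6.
Proof.
apply: (degree_pt_fibre (T := ('I_3 * bool)%type) _ (@Ftilde_span K)).
  by rewrite card_prod card_ord card_bool.
by move=> y nC _; apply: Ftilde_fibre_off_branch.
Qed.

Lemma branch_locus_Ftilde : branch_locus (Ftilde K) = C_C K.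
Proof.
apply/seteqP; split=> y.
  move=> yB; apply: contrapT => /Ftilde_fibre_off_branch[P [Pinj fP]].
  apply: not_branch_locus Pinj fP yB.
  by rewrite card_prod card_ord card_bool; exact: degree_Ftilde.
rewrite (pt_surj y); move: (y ord0 0) (y ord0 1) => p q /C_C_pt pq.
(* The cuspidal curve is parametrised by c = q / p, with c = 0 at the cusp. *)
have [c [pE qE]] : exists c, p = c ^+ 2 /\ q = c ^+ 3.
  have [p0|p0] := eqVneq p 0.
    exists 0; rewrite p0 !expr0n; split=> //; apply/eqP.
    by rewrite -sqrf_eq0 -pq p0 expr0n.
  exists (q / p); rewrite !expr_div_n (exprS q 2) -pq.
  by split; field.
pose r := sqrtC (p - (c / 2) ^+ 2).
apply: (mem_branch_locus (s := [:: pt c 0; pt (- c / 2) r; pt (- c / 2) (- r)])).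
  move=> v; rewrite (pt_surj v); move: (v ord0 0) (v ord0 1) => a b.
  rewrite Ftilde_pt => /pt_inj[ab1 ab2].
  have bE : b ^+ 2 = p - a ^+ 2 by rewrite -ab1 addrC addKr.
  (* For p = c^2 and q = c^3 the cubic has the double root -c/2. Over the root c only y = 0 is left,
     so the fibre has at most three points. *)
  have /eqP : (a - c) * (2 * a + c) ^+ 2 = 0.
    transitivity (4 * a ^+ 3 - 3 * c ^+ 2 * a - c ^+ 3); first by ring.
    by rewrite -pE -qE -ab2 -ab1; ring.
  rewrite mulf_eq0 sqrf_eq0 => /orP[].
    rewrite subr_eq0 => /eqP aE; move: bE; rewrite aE pE subrr => /eqP.
    by rewrite sqrf_eq0 => /eqP ->; rewrite inE eqxx.
  rewrite addr_eq0 => /eqP aE.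
  have {}aE : a = - c / 2 by rewrite -aE mulrC mulKf // pnatr_eq0.
  have : b ^+ 2 = r ^+ 2 by rewrite bE sqrtCK aE; congr (_ - _); ring.
  by move/eqP; rewrite eqf_sqr => /orP[]/eqP ->; rewrite aE !inE eqxx ?orbT.
by rewrite degree_Ftilde; apply: leq_ltn_trans (size_undup _) _.
Qed.

End BranchLoci.

Theorem proposition3p6 (R : realType) :
  (branch_locus (g2 R[i]) = C_C R[i] `|` C_D R[i] /\
   branch_locus (g3 R[i]) = C_C R[i] `|` C_D R[i]) /\
  branch_locus (Ftilde R[i]) = C_C R[i].
Proof.
split; last exact: branch_locus_Ftilde.
split.
  exact: (branch_locus_power_map (d := 2) isT (@g2_torus_pt _) (degree_g2 _)).
exact: (branch_locus_power_map (d := 3) isT (@g3_torus_pt _) (degree_g3 _)).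
Qed.
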